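(* Let $K$ be a totally imaginary cyclic quartic number field. Then \[ \tfrac{1}{128}\, D_K^{1/3} \le M(\mathcal{O}_K). \]
   Context: For a nonconstant polynomial $f(x)=c\prod_{i=1}^d (x-\alpha_i)\in\mathbb{C}[x]$, the Mahler measure is $M(f)=|c|\prod_{|\alpha_i|\ge 1}|\alpha_i|$. For an algebraic number $\alpha$, $M(\alpha)$ is the Mahler measure of its minimal polynomial over $\mathbb{Z}$ (with content $1$). For a number field $K$ with ring of integers $\mathcal{O}_K$ and absolute discriminant $D_K$, $M(\mathcal{O}_K)=\min\{M(\alpha):\alpha\in\mathcal{O}_K,\ \mathbb{Q}(\alpha)=K\}$. A cyclic quartic field is a Galois quartic field with Galois group $\mathbb{Z}/4\mathbb{Z}$. *)

(* Defs.v *)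
From HB Require Import structures.
From mathcomp Require Import all_boot all_order all_algebra all_fingroup all_solvable all_field.
Set Implicit Arguments.
Unset Strict Implicit.
Unset Printing Implicit Defensive.
Import GRing.Theory Num.Theory.
Local Open Scope ring_scope.

Definition mahler (f : {poly algC}) : algC :=
  `|lead_coef f| *
    \prod_(z <- sval (closed_field_poly_normal f) | 1 <= `|z|) `|z|.

Definition zpoly (R : nzRingType) (p : {poly int}) : {poly R} :=
  map_poly (fun z : int => z%:~R) p.

Section NumberField.
Variable L : fieldExtType rat.

Definition in_ring_of_integers (x : L) : Prop :=
  exists p : {poly int}, p \is monic /\ root (zpoly L p) x.

(* p is the minimal polynomial of x over Z with content 1:
   primitive (content 1, positive leading coefficient), has x as a root,
   and has minimal degree among nonzero integer polynomials vanishing at x. *)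
Definition is_Zminpoly (p : {poly int}) (x : L) : Prop :=
  [/\ zcontents p = 1, root (zpoly L p) x &
      forall q : {poly int}, q != 0 -> root (zpoly L q) x ->
        (size p <= size q)%N].

Definition mahler_of (x : L) (m : algC) : Prop :=
  exists p : {poly int}, is_Zminpoly p x /\ m = mahler (zpoly algC p).

(* Trace Tr_{L/Q}(x): trace of the Q-linear map y |-> x*y *)
Definition ftrace (x : L) : rat :=
  \sum_(i < \dim {:L}) coord (vbasis {:L}) i (x * (vbasis {:L})`_i).

Definition integral_basis (w : 'I_(\dim {:L}) -> L) : Prop :=
  [/\ forall i, in_ring_of_integers (w i),
      forall x, in_ring_of_integers x ->
        exists c : 'I_(\dim {:L}) -> int, x = \sum_i (c i)%:~R * w i &
      forall c : 'I_(\dim {:L}) -> int,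
        \sum_i (c i)%:~R * w i = 0 -> forall i, c i = 0].

Definition disc_of (w : 'I_(\dim {:L}) -> L) : rat :=
  \det (\matrix_(i, j) ftrace (w i * w j)).

Definition abs_disc (w : 'I_(\dim {:L}) -> L) : rat := `|disc_of w|.

End NumberField.

(* Main.v *)
Require Import Defs.
From HB Require Import structures.
From mathcomp Require Import all_boot all_order all_algebra all_fingroup all_solvable all_field.
From mathcomp Require Import ring.
Import Order.TTheory GRing.Theory Num.Theory.
Local Open Scope ring_scope.

(* Let sigma generate Gal(K/Q) and put
     gam := (alpha - sigma^2 alpha) * (sigma alpha - sigma^3 alpha),
   so that sigma gam = - gam.  The four algebraic integers
   1, gam, alpha, gam * alpha span a lattice of discriminant 16 gam^6 <> 0,
   hence |D_K| <= 16 |gam|^6.  As K is totally imaginary, sigma^2 is complex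
   conjugation, so that alpha and sigma^2 alpha have the same modulus, as do
   sigma alpha and sigma^3 alpha.  Hence |gam| <= 4 |alpha| |sigma alpha|,
   |gam|^2 <= 16 M(alpha) and |D_K| <= 2^16 M(alpha)^3. *)

(** * Complex embeddings *)

(** Take a complex root [z] of the minimal polynomial of [a] and send q(a) to q(z). This is well
    defined: if q(a) = r(a), the minimal polynomial divides q - r, so q(z) = r(z). *)
Lemma num_field_embedding (L : fieldExtType rat) (a : L) :
  <<1%VS; a>>%VS = fullv -> {rmorphism L -> algC}.
Proof.
move=> gen_a.
have /polyOver1P/sig_eqW[mq Dmq] := minPolyOver 1 a.
have /sigW[z rz]: exists z, root (map_poly (ratr : rat -> algC) mq) z.
  apply/closed_rootP; rewrite size_map_poly -(size_map_poly (in_alg L)) -Dmq.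
  by rewrite size_minPoly eqSS -lt0n.
have polyrep x : {q : {poly rat} | (map_poly (in_alg L) q).[a] = x}.
  apply: sig_eqW; have: x \in <<1%VS; a>>%VS by rewrite gen_a memvf.
  by case/Fadjoin_polyP=> _ /polyOver1P[q ->] ->; exists q.
have key (q r : {poly rat}) :
    (map_poly (in_alg L) q).[a] = (map_poly (in_alg L) r).[a] ->
  (map_poly (ratr : rat -> algC) q).[z] = (map_poly ratr r).[z].
  move/eqP; rewrite -subr_eq0 -hornerN -hornerD -!rmorphB => qr0.
  apply/eqP; rewrite -subr_eq0 -hornerN -hornerD -!rmorphB.
  have: minPoly 1 a %| map_poly (in_alg L) (q - r).
    by apply: minPoly_dvdp => //; apply/polyOver1P; exists (q - r).
  rewrite Dmq dvdp_map => /dvdpP[u ->].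
  by rewrite rmorphM hornerM (rootP rz) mulr0.
pose s x := (map_poly (ratr : rat -> algC) (sval (polyrep x))).[z].
have sE q : s (map_poly (in_alg L) q).[a] = (map_poly ratr q).[z].
  by apply: key; case: (polyrep _).
have sB : zmod_morphism s.
  move=> x y; rewrite -[x](svalP (polyrep x)) -[y](svalP (polyrep y)).
  by rewrite -hornerN -hornerD -rmorphB !sE rmorphB hornerD hornerN.
have sM : monoid_morphism s.
  split=> [|x y].
    have {1}->: 1 = (map_poly (in_alg L) 1).[a] by rewrite rmorph1 hornerC.
    by rewrite sE rmorph1 hornerC.
  rewrite -[x](svalP (polyrep x)) -[y](svalP (polyrep y)).
  by rewrite -hornerM -rmorphM !sE rmorphM hornerM.
pose sBm := GRing.isZmodMorphism.Build L algC s sB.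
pose sMm := GRing.isMonoidMorphism.Build L algC s sM.
exact: (HB.pack s sBm sMm : {rmorphism L -> algC}).
Qed.

(** * Discriminants through conjugates *)

Section Discriminant.

Variables (L : fieldExtType rat).
Local Notation n := (\dim {:L}).
Variable tau : 'I_n -> {rmorphism L -> algC}.

Definition conj_mx (v : 'I_n -> L) : 'M[algC]_n := \matrix_(i, k) tau k (v i).

(* The family v only witnesses that the tau k are linearly independent, i.e.
   that they are all the embeddings of L. *)
Lemma ftrace_sum_conj (v : 'I_n -> L) (x : L) :
  \det (conj_mx v) != 0 -> ratr (ftrace x) = \sum_k tau k x.
Proof.
pose b := vbasis {:L} => det_v.
pose E := conj_mx (fun i => b`_i).
have expand y k : tau k y = \sum_j ratr (coord b j y) * tau k b`_j.
  rewrite {1}(coord_vbasis (memvf y)) rmorph_sum /=.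
  by apply: eq_bigr => j _; rewrite rmorphZ_num.
have unitE : E \in unitmx.
  have Dv : conj_mx v = (\matrix_(i, j) ratr (coord b j (v i))) *m E.
    apply/matrixP=> i k; rewrite !mxE expand.
    by apply: eq_bigr => j _; rewrite !mxE.
  move: det_v; rewrite Dv det_mulmx mulf_eq0 negb_or => /andP[_].
  by rewrite unitmxE unitfE.
pose A : 'M[algC]_n := \matrix_(i, j) ratr (coord b j (x * b`_i)).
pose D := diag_mx (\row_k tau k x).
(* Column [k] of [E] is an eigenvector of multiplication by [x], with eigenvalue [tau k x]; as [E]
   is invertible, [A] and [D] have the same trace. *)
have AE : A *m E = E *m D.
  apply/matrixP=> i k; rewrite mul_mx_diag !mxE -rmorphM mulrC expand.
  by apply: eq_bigr => j _; rewrite !mxE.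
have -> : ratr (ftrace x) = \tr A.
  by rewrite rmorph_sum; apply: eq_bigr => i _; rewrite mxE.
rewrite -(mulmxK unitE A) AE mxtrace_mulC mulmxA mulVmx // mul1mx.
by rewrite mxtrace_diag; apply: eq_bigr => k _; rewrite mxE.
Qed.

(** The trace matrix of [w] is [conj_mx w] times its transpose. *)
Lemma disc_of_det (v w : 'I_n -> L) :
  \det (conj_mx v) != 0 -> ratr (disc_of w) = \det (conj_mx w) ^+ 2.
Proof.
move=> det_v; rewrite expr2 -{2}det_tr -det_mulmx -det_map_mx.
congr (\det _); apply/matrixP=> i j; rewrite !mxE /= (ftrace_sum_conj v) //.
by apply: eq_bigr => k _; rewrite !mxE rmorphM.
Qed.

(** Writing [v] over the integral basis [w] multiplies [\det (conj_mx w)] by the determinant of an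
    integer matrix, which is nonzero and hence of modulus at least 1. *)
Lemma abs_disc_min (w v : 'I_n -> L) :
  integral_basis w -> (forall i, in_ring_of_integers (v i)) ->
  \det (conj_mx v) != 0 ->
  ratr (abs_disc w) <= `|\det (conj_mx v)| ^+ 2.
Proof.
case=> _ gen_w _ int_v det_v.
have [c Dc] : exists c : 'M[int]_n, forall i, v i = \sum_j (c i j)%:~R * w j.
  have /fin_all_exists[c Dc] i := gen_w _ (int_v i).
  exists (\matrix_(i, j) c i j) => i.
  by rewrite Dc; apply: eq_bigr => j _; rewrite mxE.
have Dv : conj_mx v = map_mx intr c *m conj_mx w.
  apply/matrixP=> i k; rewrite !mxE Dc rmorph_sum /=.
  by apply: eq_bigr => j _; rewrite !mxE rmorphM /= rmorph_int.
rewrite /abs_disc -normrX ratr_norm (disc_of_det v) //.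
move: det_v; rewrite Dv det_mulmx mulf_eq0 negb_or => /andP[det_c _].
rewrite exprMn [X in _ <= X]normrM ler_peMl //.
by rewrite normrX exprn_ege1 // norm_intr_ge1 // det_map_mx /= intr_int.
Qed.

End Discriminant.

Arguments conj_mx {L} tau v.

(** Conjugates of 1, gam, alpha, gam * alpha: column [j] belongs to sigma^j, and the signs of [g]
    alternate because sigma gam = - gam. *)
Lemma det_quartic (R : comNzRingType) (a b c d g : R) n : n = 4%N ->
  \det (\matrix_(i < n, j < n)
    nth 0 (nth [::] [:: [:: 1; 1; 1; 1];
                        [:: g; - g; g; - g];
                        [:: a; b; c; d];
                        [:: g * a; - (g * b); g * c; - (g * d)]] i) j)
  = 4%:R * g ^+ 2 * ((a - c) * (b - d)).
Proof.
move=> ->; rewrite (expand_det_row _ ord0) !big_ord_recl big_ord0.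
do 2!rewrite /cofactor !(expand_det_row _ ord0) !big_ord_recl !big_ord0.
by rewrite /cofactor !det_mx11 !mxE /=; ring.
Qed.

(** * Mahler measure *)

(** Distinct roots all occur in the full list of roots; the factors left over and the leading
    coefficient have modulus at least 1. *)
Lemma mahler_ge_prod_roots (p : {poly algC}) (rs : seq algC) :
  1 <= `|lead_coef p| -> uniq rs -> all (root p) rs ->
  \prod_(z <- rs | 1 <= `|z|) `|z| <= mahler p.
Proof.
move=> lead_p uniq_rs roots_rs; rewrite /mahler.
case: closed_field_poly_normal => r /= Dp.
have{Dp roots_rs}: {subset rs <= r}.
  move=> z /(allP roots_rs); rewrite Dp rootZ ?root_prod_XsubC //.
  by apply: contraTneq lead_p => ->; rewrite normr0 ler10.
have prod_ge1 t : 1 <= \prod_(z <- t | 1 <= `|z|) `|z| :> algC.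
  by elim/big_ind: _ => // x y; apply: mulr_ege1.
move=> sub_rs_r.
apply: le_trans (_ : _ <= \prod_(z <- r | 1 <= `|z|) `|z|) _; last first.
  by rewrite ler_peMl // (le_trans ler01) ?prod_ge1.
(* Each [z] is removed from [r] once; by uniqueness the rest of [rs] still lies in what remains. *)
elim: rs r uniq_rs sub_rs_r => [|z rs IHrs] r /=; first by rewrite big_nil.
case/andP=> z'rs uniq_rs sub_rs.
have rz : z \in r by rewrite sub_rs ?mem_head.
rewrite (perm_big _ (perm_to_rem rz)) /= !big_cons.
have IH : \prod_(y <- rs | 1 <= `|y|) `|y|
    <= \prod_(y <- rem z r | 1 <= `|y|) `|y|.
  apply: IHrs => // y rs_y; have: y \in r by rewrite sub_rs // inE rs_y orbT.
  rewrite (perm_mem (perm_to_rem rz)) inE => /predU1P[] // Dy.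
  by rewrite -Dy rs_y in z'rs.
by case: ifP => // _; apply: ler_wpM2l.
Qed.

Lemma root_zpoly_morph (R S : comNzRingType) (f : {rmorphism R -> S})
    (p : {poly int}) (x : R) :
  root (zpoly R p) x -> root (zpoly S p) (f x).
Proof.
move=> /rootP px0; apply/rootP.
have -> : zpoly S p = map_poly f (zpoly R p).
  by apply/polyP=> i; rewrite !coef_map_id0 ?rmorph0 ?rmorph_int ?mulr0z.
by rewrite horner_map px0 rmorph0.
Qed.

(** * Algebraic integers *)

Section IntegerClosure.

Variable L : fieldExtType rat.
Implicit Types x y : L.

Lemma in_ring_of_integersP x :
  in_ring_of_integers x <-> integralOver (intr : int -> L) x.
Proof. by split=> [[p []]|[p]]; exists p. Qed.

Lemma in_ring_of_integers1 : in_ring_of_integers (1 : L).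
Proof. by apply/in_ring_of_integersP/integral1. Qed.

Lemma in_ring_of_integersB x y :
  in_ring_of_integers x -> in_ring_of_integers y -> in_ring_of_integers (x - y).
Proof.
move=> /in_ring_of_integersP int_x /in_ring_of_integersP int_y.
by apply/in_ring_of_integersP/integral_sub.
Qed.

Lemma in_ring_of_integersM x y :
  in_ring_of_integers x -> in_ring_of_integers y -> in_ring_of_integers (x * y).
Proof.
move=> /in_ring_of_integersP int_x /in_ring_of_integersP int_y.
by apply/in_ring_of_integersP/integral_mul.
Qed.

Lemma in_ring_of_integers_morph (f : {rmorphism L -> L}) x :
  in_ring_of_integers x -> in_ring_of_integers (f x).
Proof. by case=> p [mon_p px0]; exists p; split=> //; apply: root_zpoly_morph. Qed.

End IntegerClosure.

(** * The cyclic quartic bound *)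

Theorem theorem6p1 (K : splittingFieldType rat)
  (Kdeg : \dim {:K} = 4%N)
  (Kgal : galois 1%VS {:K})
  (Kcyc : cyclic 'Gal({:K} / 1%VS))
  (Kimag : forall s : {rmorphism K -> algC}, exists x : K, s x \notin Num.real)
  (w : 'I_(\dim {:K}) -> K) (Hw : integral_basis w)
  (alpha : K) (Halpha : in_ring_of_integers alpha)
  (Hgen : <<1%VS; alpha>>%VS = fullv)
  (m : algC) (Hm : mahler_of alpha m) :
  3.-root (ratr (abs_disc w)) / 128%:R <= m.
Proof.
have [g Dg] := cyclicP Kcyc.
have og : #[g]%g = 4%N by rewrite /order -Dg -galois_dim // dimv1 divn1.
have gX j k x : (g ^+ k)%g ((g ^+ j)%g x) = (g ^+ (j + k))%g x.
  by rewrite expgD galM ?memvf.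
have gmod k x : (g ^+ k)%g x = (g ^+ (k %% 4))%g x.
  by rewrite -og expg_mod_order.
have ginj j k : (g ^+ j)%g alpha = (g ^+ k)%g alpha -> (j == k %[mod 4])%N.
  move=> eq_jk; rewrite -og -eq_expg_mod_order; apply/gal_eqP=> x _.
  have: x \in <<1%VS; alpha>>%VS by rewrite Hgen memvf.
  case/Fadjoin_polyP=> p Qp ->; rewrite -!horner_map.
  by rewrite !(fixedPoly_gal (sub1v _)) ?Dg ?mem_cycle //= eq_jk.
pose s := num_field_embedding _ _ Hgen.
(* Since K is normal, complex conjugation restricts to some [g ^+ i]. It is an involution, so 2i = 0
   mod 4, and i = 0 mod 4 would make the image of [s] real, against [Kimag]. *)
have conj_s x : (s x)^* = s ((g ^+ 2)%g x).
  have [nu Dnu] := restrict_aut_to_normal_num_field s Num.conj.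
  have nu_hom : kHom 1 {:K} (linfun nu).
    apply/kHom_monoid_morphism; split=> [|y z]; rewrite !lfunE /=.
      exact: rmorph1.
    exact: rmorphM.
  have [_ _ nK] := and3P Kgal.
  have [|h] := kHom_to_gal _ nK nu_hom; first by rewrite sub1v subvv.
  rewrite Dg => /cycleP[i ->] Dh.
  have{Dnu nu_hom} Ds y : (s y)^* = s ((g ^+ i)%g y).
    by rewrite -Dnu -Dh ?memvf // lfunE.
  have: (g ^+ (i + i))%g alpha = (g ^+ 0)%g alpha.
    by apply: (fmorph_inj s); rewrite -gX -!Ds conjCK expg0 gal_id.
  move/ginj; rewrite Ds gmod addnn -muln2 => i2.
  suffices ->: (i %% 4 = 2)%N by [].
  have i_neq0 : (i %% 4 != 0)%N.
    have [y] := Kimag s; apply: contra => /eqP i0.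
    by rewrite CrealE Ds gmod i0 expg0 gal_id.
  move: i2 i_neq0; rewrite -modnMml.
  by have := ltn_pmod i (isT : (0 < 4)%N); case: (i %% 4)%N => [|[|[|[|[]]]]].
(* Abstracting gam over its value keeps rmorphM from seeing the product. *)
have [gam gamE] : exists gam,
  gam = (alpha - (g ^+ 2)%g alpha) * (g alpha - (g ^+ 3)%g alpha) by eexists.
pose v (i : nat) : K := [:: 1; gam; alpha; gam * alpha]`_i.
pose tau k : {rmorphism K -> algC} := s \o (g ^+ k)%g.
have gam_neq0 : gam != 0.
  rewrite gamE mulf_neq0 // subr_eq0.
    by apply/eqP; move: (ginj 0%N 2%N); rewrite expg0 gal_id => E /E.
  by apply/eqP; move: (ginj 1%N 3%N); rewrite expg1 => E /E.
(* [g] sends the first factor of [gam] to the second, and the second to minus the first because [g]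
   has order 4. *)
have Dgam k : (g ^+ k)%g gam = (-1) ^+ k * gam.
  elim: k => [|k IHk]; first by rewrite expg0 gal_id mul1r.
  rewrite -addn1 -gX expg1 IHk rmorphM rmorphXn rmorphN1 exprD -mulrA.
  congr (_ * _); rewrite expr1 gamE rmorphM !rmorphB /= -(expg1 g) !gX.
  by rewrite (gmod (3 + 1)%N) expg0 gal_id; ring.
pose tau' (k : 'I_(\dim {:K})) := tau k.
pose v' (i : 'I_(\dim {:K})) := v i.
have lt4 (i : 'I_(\dim {:K})) : (i < 4)%N by case: i => i; rewrite /= Kdeg.
(* The factor (a - c)(b - d) in [det_quartic] is here [s gam] itself, hence the cube. *)
have det_v : \det (conj_mx tau' v') = 4%:R * s gam ^+ 3.
  rewrite [RHS](_ : _ = 4%:R * s gam ^+ 2 * ((s alpha - s ((g ^+ 2)%g alpha))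
    * (s (g alpha) - s ((g ^+ 3)%g alpha)))); last first.
    by rewrite -!rmorphB -rmorphM -gamE -mulrA -exprSr.
  rewrite -(det_quartic _ _ _ _ _ _ _ Kdeg); congr (\det _).
  apply/matrixP=> i j; rewrite !mxE /tau' /v' /tau /v /=.
  move: (lt4 i) (lt4 j).
  case: (i : nat) => [|[|[|[|[]]]]] //;
    case: (j : nat) => [|[|[|[|[]]]]] //= _ _;
    rewrite ?(rmorph1, rmorphM) /= ?Dgam ?(expg0, expg1, gal_id);
    by rewrite ?rmorphM ?rmorphXn ?rmorphN1 /=; ring.
have int_gX k : in_ring_of_integers ((g ^+ k)%g alpha).
  exact: in_ring_of_integers_morph.
have int_gam : in_ring_of_integers gam.
  have := int_gX 1%N; rewrite expg1 gamE => int_g.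
  by apply: in_ring_of_integersM; apply: in_ring_of_integersB.
have int_v i : in_ring_of_integers (v' i).
  rewrite /v' /v; have := lt4 i.
  case: (i : nat) => [|[|[|[|[]]]]] //= _.
    exact: in_ring_of_integers1.
  exact: in_ring_of_integersM.
have disc_le : ratr (abs_disc w) <= `|4%:R * s gam ^+ 3| ^+ 2.
  rewrite -det_v; apply: abs_disc_min => //.
  by rewrite det_v mulf_neq0 ?pnatr_eq0 // expf_neq0 ?fmorph_eq0.
have norm_s2 x : `|s ((g ^+ 2)%g x)| = `|s x| by rewrite -conj_s norm_conjC.
have norm_s3 : `|s ((g ^+ 3)%g alpha)| = `|s (g alpha)|.
  rewrite -(norm_s2 (g alpha)).
  by move: (gX 1%N 2%N alpha); rewrite expg1 => ->.
have norm_gam : `|s gam| <= 4 * (`|s alpha| * `|s (g alpha)|).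
  rewrite gamE !rmorphM !rmorphB normrM.
  have -> : 4 * (`|s alpha| * `|s (g alpha)|)
    = (`|s alpha| + `|s ((g ^+ 2)%g alpha)|)
      * (`|s (g alpha)| + `|s ((g ^+ 3)%g alpha)|).
    by rewrite norm_s2 norm_s3; ring.
  by rewrite ler_pM // ler_normB.
have [p [[cont_p p_alpha _] Dm]] := Hm.
(* This is max(1, |x|), with the same test as the filter in [mahler]. *)
pose mx1 (x : algC) := if 1 <= `|x| then `|x| else 1.
have mx1_ge x : `|x| <= mx1 x.
  rewrite /mx1; case: ifP => // /negbT.
  by rewrite -real_ltNge ?normr_real ?real1 // => /ltW.
(* One factor per pair of complex conjugates, so [t ^+ 2] runs over all four conjugates of
   [alpha]. *)
pose t := mx1 (s alpha) * mx1 (s (g alpha)).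
have m_ge : t ^+ 2 <= m.
  have p_neq0 : p != 0 by apply: contra_eq_neq cont_p => ->; rewrite zcontents0.
  pose rs := [seq s ((g ^+ k)%g alpha) | k <- iota 0 4].
  have /mahler_ge_prod_roots : 1 <= `|lead_coef (zpoly algC p)|.
    rewrite lead_coef_map_inj //; last exact: intr_inj.
    by rewrite norm_intr_ge1 ?intr_int // intr_eq0 lead_coef_eq0.
  move=> /(_ rs); rewrite -Dm => le_m; apply: le_trans (le_m _ _).
  - rewrite (_ : \prod_(z <- rs | _) _ = t ^+ 2) // /rs /= !big_cons big_nil.
    rewrite expg0 gal_id expg1 norm_s2 norm_s3 /t /mx1.
    by case: (1 <= `|s alpha|); case: (1 <= `|s (g alpha)|); ring.
  - rewrite map_inj_in_uniq ?iota_uniq // => j k.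
    rewrite !mem_iota => /andP[_ lt_j] /andP[_ lt_k] /fmorph_inj/ginj.
    by rewrite !modn_small // => /eqP.
  - apply/allP=> _ /mapP[k _ ->].
    exact: (@root_zpoly_morph K algC (tau k)).
have sgam_le : `|s gam| <= 2%:R ^+ 2 * t.
  rewrite (le_trans norm_gam) // -natrX ler_wpM2l ?ler0n //.
  by rewrite ler_pM ?mx1_ge.
have t_ge0 : 0 <= t by rewrite mulr_ge0 // (le_trans _ (mx1_ge _)).
have m_ge0 : 0 <= m by apply: le_trans m_ge; rewrite exprn_ge0.
(* Both sides are nonnegative, so the claim may be cubed to |D_K| <= (128 m)^3. *)
rewrite ler_pdivrMr ?ltr0n // -(ler_pXn2r (isT : (0 < 3)%N)) ?nnegrE; last first.
  - by rewrite mulr_ge0.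
  - by rewrite rootC_ge0 // ler0q normr_ge0.
rewrite rootCK // (le_trans disc_le) // normrM normr_nat normrX.
(* 2^16 comes from (4 * (4t)^3)^2 = 2^16 t^6, while 128^3 = 2^21. *)
apply: le_trans (_ : 2%:R ^+ 16 * (t ^+ 2) ^+ 3 <= _).
  have -> : 2%:R ^+ 16 * (t ^+ 2) ^+ 3
      = (4%:R * (2%:R ^+ 2 * t) ^+ 3) ^+ 2 by ring.
  have four_t_ge0 : 0 <= 2%:R ^+ 2 * t by rewrite mulr_ge0 ?exprn_ge0.
  apply: lerXn2r; rewrite ?nnegrE.
  - by rewrite !mulr_ge0 ?exprn_ge0.
  - by rewrite mulr_ge0 ?exprn_ge0.
  - by rewrite ler_pM2l ?ltr0n //; apply: lerXn2r; rewrite ?nnegrE.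
have -> : (m * 128%:R) ^+ 3 = 2%:R ^+ 21 * m ^+ 3.
  by rewrite -[128%N]/(2 ^ 7)%N natrX; ring.
rewrite ler_pM ?exprn_ge0 //; last by rewrite lerXn2r ?nnegrE ?exprn_ge0.
by rewrite ler_weXn2l // ler1n.
Qed.
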